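(* For any proof system $\mathbf{P}$ such that $\mathbf{P}$ is at least as strong as $\mathbf{FL_e}$ and $\mathbf{P}\leq\mathbf{CFL_{ew}^-}$, there is an exponential lower bound on the length of proofs in $\mathbf{P}$. As a result, there are exponential lower bounds on the length of proofs in the sequent calculi $\mathbf{CFL_e^-}$, $\mathbf{CFL_{ei}^-}$ and $\mathbf{CFL_{eo}^-}$.
   Context: **Exponential lower bound.** There is an exponential lower bound on the length of proofs in $\mathbf{P}$ if there is a sequence $\{A_n\}_{n\ge1}$ of $\mathbf P$-provable formulas with $|A_n|$ bounded by a polynomial in $n$, and an $\varepsilon>0$, such that every $\mathbf P$-proof of $A_n$ has length at least $2^{n^{\varepsilon}}$ for all sufficiently large $n$. Length means number of symbols. **Proof systems.** A proof system for a logic (set of formulas) $\mathsf{L}$ is a polynomial-time computable function $\mathbf{P}$ with range $\mathsf{L}$; $\pi$ is a $\mathbf{P}$-proof of $\phi$ if $\mathbf{P}(\pi)=\phi$. $\mathbf{Q}$ is at least as strong as $\mathbf{P}$ if every formula with a $\mathbf P$-proof has a $\mathbf Q$-proof. $\mathbf{P}\leq\mathbf{Q}$ ($\mathbf Q$ simulates $\mathbf P$) if there is a polynomial $g$ such that for every $\pi$ there is $\pi'$ with $\mathbf{Q}(\pi')=\mathbf{P}(\pi)$ and $|\pi'|\le g(|\pi|)$. A sequent calculus is regarded as a proof system for the set of formulas $\phi$ such that $(\Rightarrow\phi)$ is provable in it. Formulas are over the language $\{\wedge,\vee,*,\to,0,1\}$. **The multi-conclusion calculi.** Sequents $\Gamma\Rightarrow\Delta$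 with $\Gamma,\Delta$ finite (possibly empty) sequences of formulas. Initial sequents: $\phi\Rightarrow\phi$; $\Rightarrow1$; $0\Rightarrow$. Rules of $\mathbf{CFL_e^-}$ (premises / conclusion): exchange: $\Gamma,\phi,\psi,\Sigma\Rightarrow\Delta$ / $\Gamma,\psi,\phi,\Sigma\Rightarrow\Delta$ and $\Gamma\Rightarrow\Delta,\phi,\psi,\Lambda$ / $\Gamma\Rightarrow\Delta,\psi,\phi,\Lambda$; $(1w)$ $\Gamma,\Sigma\Rightarrow\Delta$ / $\Gamma,1,\Sigma\Rightarrow\Delta$; $(0w)$ $\Gamma\Rightarrow\Delta,\Lambda$ / $\Gamma\Rightarrow\Delta,0,\Lambda$; $(L\wedge)$ $\Gamma,\phi,\Sigma\Rightarrow\Delta$ (or $\Gamma,\psi,\Sigma\Rightarrow\Delta$) / $\Gamma,\phi\wedge\psi,\Sigma\Rightarrow\Delta$; $(R\wedge)$ $\Gamma\Rightarrow\Delta,\phi,\Lambda$ and $\Gamma\Rightarrow\Delta,\psi,\Lambda$ / $\Gamma\Rightarrow\Delta,\phi\wedge\psi,\Lambda$; $(L\vee)$ $\Gamma,\phi,\Sigma\Rightarrow\Delta$ and $\Gamma,\psi,\Sigma\Rightarrow\Delta$ / $\Gamma,\phi\vee\psi,\Sigma\Rightarrow\Delta$; $(R\vee)$ $\Gamma\Rightarrow\Delta,\phi,\Lambda$ (or $\Gamma\Rightarrow\Delta,\psi,\Lambda$) / $\Gamma\Rightarrow\Delta,\phi\vee\psi,\Lambda$; $(L* )$ $\Gamma,\phi,\psi,\Sigma\Rightarrow\Delta$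 / $\Gamma,\phi*\psi,\Sigma\Rightarrow\Delta$; $(R* )$ $\Gamma\Rightarrow\Delta,\phi,\Lambda$ and $\Sigma\Rightarrow\Delta,\psi,\Lambda$ / $\Gamma,\Sigma\Rightarrow\Delta,\phi*\psi,\Lambda$; $(L\to)$ $\Gamma\Rightarrow\phi,\Lambda$ and $\Pi,\psi,\Sigma\Rightarrow\Delta$ / $\Pi,\Gamma,\phi\to\psi,\Sigma\Rightarrow\Delta,\Lambda$; $(R\to)$ $\phi,\Gamma\Rightarrow\psi,\Delta$ / $\Gamma\Rightarrow\phi\to\psi,\Delta$. There is no cut rule (superscript $-$). $\mathbf{CFL_{ei}^-}$ adds left weakening $(i)$ $\Gamma,\Sigma\Rightarrow\Delta$ / $\Gamma,\phi,\Sigma\Rightarrow\Delta$; $\mathbf{CFL_{eo}^-}$ adds right weakening $(o)$ $\Gamma\Rightarrow\Delta,\Lambda$ / $\Gamma\Rightarrow\Delta,\phi,\Lambda$; $\mathbf{CFL_{ew}^-}$ adds both. **$\mathbf{FL_e}$** (over the same language) consists of the single-conclusion instances (every sequent has at most one formula on the right) of the initial sequents and rules of $\mathbf{CFL_e^-}$ above, together with the cut rule $\Gamma\Rightarrow\phi$ and $\Sigma,\phi,\Pi\Rightarrow\Delta$ / $\Sigma,\Gamma,\Pi\Rightarrow\Delta$ ($\Delta$ empty or one formula). *)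

(* Defs.v *)
From HB Require Import structures.
From mathcomp Require Import all_boot all_order all_algebra.
From mathcomp Require Import reals exp.

Set Implicit Arguments.
Unset Strict Implicit.
Unset Printing Implicit Defensive.

Import Order.TTheory GRing.Theory Num.Theory.

(* The countably many propositional variables are subscripted by binary words,
   so that writing down a variable costs the length of its subscript. *)
Inductive formula : Type :=
  | Var of seq bool
  | Zero
  | One
  | And of formula & formula
  | Or of formula & formula
  | Fus of formula & formula
  | Imp of formula & formula.

Lemma formula_comparable : comparable formula.
Proof.
rewrite /comparable /decidable; decide equality.
by apply: (@eq_comparable (seq bool)).
Defined.

HB.instance Definition _ := hasDecEq.Build formula (compareP formula_comparable).

Definition sequent : Type := (seq formula * seq formula)%type.

Notation "G ⇒ D" := ((G, D) : sequent) (at level 70, no associativity).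

(** ** Formulas and proofs as words over a finite alphabet *)

Inductive symbol : Type :=
  | SVar | SBit of bool | SZero | SOne | SAnd | SOr | SFus | SImp
  | SLpar | SRpar | SComma | SArrow | SSemicolon.

Definition symbol_code (s : symbol) : 'I_14 :=
  match s with
  | SVar => inord 0 | SBit false => inord 1 | SBit true => inord 2
  | SZero => inord 3 | SOne => inord 4 | SAnd => inord 5 | SOr => inord 6
  | SFus => inord 7 | SImp => inord 8 | SLpar => inord 9 | SRpar => inord 10
  | SComma => inord 11 | SArrow => inord 12 | SSemicolon => inord 13
  end.

Definition symbol_decode (i : 'I_14) : symbol :=
  nth SVar [:: SVar; SBit false; SBit true; SZero; SOne; SAnd; SOr; SFus; SImp;
               SLpar; SRpar; SComma; SArrow; SSemicolon] i.

Lemma symbol_codeK : cancel symbol_code symbol_decode.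
Proof. by do ?case; rewrite /symbol_decode /= inordK. Qed.

HB.instance Definition _ := Finite.copy symbol (can_type symbol_codeK).

Fixpoint formula_word (phi : formula) : seq symbol :=
  let bin a c b := SLpar :: formula_word a ++ c :: rcons (formula_word b) SRpar in
  match phi with
  | Var w => SVar :: map SBit w
  | Zero => [:: SZero]
  | One => [:: SOne]
  | And a b => bin a SAnd b
  | Or a b => bin a SOr b
  | Fus a b => bin a SFus b
  | Imp a b => bin a SImp b
  end.

Definition formulas_word (G : seq formula) : seq symbol :=
  flatten [seq rcons (formula_word phi) SComma | phi <- G].

Definition sequent_word (s : sequent) : seq symbol :=
  formulas_word s.1 ++ SArrow :: formulas_word s.2.

Definition proof_word (pi : seq sequent) : seq symbol :=
  flatten [seq rcons (sequent_word s) SSemicolon | s <- pi].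

Definition formula_size (phi : formula) : nat := size (formula_word phi).

(** ** Sequent calculi *)

(* [CFL i o premises conclusion]: the inferences of the cut-free
   multi-conclusion calculus, with left weakening when [i] holds and right
   weakening when [o] holds.  The right contexts [D], [L] of the fusion rule
   are shared by its two premises. *)
Inductive CFL (i o : bool) : seq sequent -> sequent -> Prop :=
  | Ax phi : CFL i o [::] ([:: phi] ⇒ [:: phi])
  | Ax1 : CFL i o [::] ([::] ⇒ [:: One])
  | Ax0 : CFL i o [::] ([:: Zero] ⇒ [::])
  | ExL G phi psi S D :
      CFL i o [:: G ++ phi :: psi :: S ⇒ D] (G ++ psi :: phi :: S ⇒ D)
  | ExR G D phi psi L :
      CFL i o [:: G ⇒ D ++ phi :: psi :: L] (G ⇒ D ++ psi :: phi :: L)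
  | W1 G S D : CFL i o [:: G ++ S ⇒ D] (G ++ One :: S ⇒ D)
  | W0 G D L : CFL i o [:: G ⇒ D ++ L] (G ⇒ D ++ Zero :: L)
  | LAnd1 G phi psi S D :
      CFL i o [:: G ++ phi :: S ⇒ D] (G ++ And phi psi :: S ⇒ D)
  | LAnd2 G phi psi S D :
      CFL i o [:: G ++ psi :: S ⇒ D] (G ++ And phi psi :: S ⇒ D)
  | RAnd G D phi psi L :
      CFL i o [:: G ⇒ D ++ phi :: L; G ⇒ D ++ psi :: L]
              (G ⇒ D ++ And phi psi :: L)
  | LOr G phi psi S D :
      CFL i o [:: G ++ phi :: S ⇒ D; G ++ psi :: S ⇒ D]
              (G ++ Or phi psi :: S ⇒ D)
  | ROr1 G D phi psi L :
      CFL i o [:: G ⇒ D ++ phi :: L] (G ⇒ D ++ Or phi psi :: L)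
  | ROr2 G D phi psi L :
      CFL i o [:: G ⇒ D ++ psi :: L] (G ⇒ D ++ Or phi psi :: L)
  | LFus G phi psi S D :
      CFL i o [:: G ++ phi :: psi :: S ⇒ D] (G ++ Fus phi psi :: S ⇒ D)
  | RFus G S D phi psi L :
      CFL i o [:: G ⇒ D ++ phi :: L; S ⇒ D ++ psi :: L]
              (G ++ S ⇒ D ++ Fus phi psi :: L)
  | LImp G phi L P psi S D :
      CFL i o [:: G ⇒ phi :: L; P ++ psi :: S ⇒ D]
              (P ++ G ++ Imp phi psi :: S ⇒ D ++ L)
  | RImp phi G psi D :
      CFL i o [:: phi :: G ⇒ psi :: D] (G ⇒ Imp phi psi :: D)
  | WL G phi S D : i -> CFL i o [:: G ++ S ⇒ D] (G ++ phi :: S ⇒ D)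
  | WR G D phi L : o -> CFL i o [:: G ⇒ D ++ L] (G ⇒ D ++ phi :: L).

Definition single_conclusion (s : sequent) : bool := size s.2 <= 1.

Inductive FLe_inference : seq sequent -> sequent -> Prop :=
  | FLe_base ps c :
      CFL false false ps c -> all single_conclusion (c :: ps) ->
      FLe_inference ps c
  | FLe_cut G phi S P D :
      size D <= 1 ->
      FLe_inference [:: G ⇒ [:: phi]; S ++ phi :: P ⇒ D] (S ++ G ++ P ⇒ D).

(* Proofs are sequences of sequents, so an already derived sequent may be used
   as a premise any number of times. *)
Inductive derivation (inference : seq sequent -> sequent -> Prop) :
    seq sequent -> Prop :=
  | derivation_nil : derivation inference [::]
  | derivation_rcons pi ps c :
      derivation inference pi -> {subset ps <= pi} -> inference ps c ->
      derivation inference (rcons pi c).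

(** ** Polynomial-time computability *)

Inductive move : Type := MoveLeft | Stay | MoveRight.

(* Deterministic machines with one two-way infinite tape.  A cell is blank
   ([None]) or holds an input symbol, an output symbol or an auxiliary symbol;
   the machine halts when its transition function returns [None]. *)
Record machine (I O : finType) : Type := Machine {
  state : finType;
  aux : finType;
  start : state;
  delta : state -> option (I + O + aux) ->
          option (state * option (I + O + aux) * move) }.

Section Machine.

Variables (I O : finType) (M : machine I O).

Let cell : Type := option (I + O + aux M).

(* The cells to the left of the head are listed from right to left; cells
   beyond either end of the listed part of the tape are blank. *)
Record config : Type := Config {
  cstate : state M;
  cleft : seq cell;
  chead : cell;
  cright : seq cell }.

Definition input_cell (a : I) : cell := Some (inl (inl a)).
Definition output_cell (b : O) : cell := Some (inl (inr b)).

Definition initial (w : seq I) : config :=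
  let t := map input_cell w in
  Config (start M) [::] (head None t) (behead t).

Definition step (c : config) : option config :=
  if delta (cstate c) (chead c) is Some (q, a, m) then
    Some match m with
    | MoveLeft =>
        Config q (behead (cleft c)) (head None (cleft c)) (a :: cright c)
    | Stay => Config q (cleft c) a (cright c)
    | MoveRight =>
        Config q (a :: cleft c) (head None (cright c)) (behead (cright c))
    end
  else None.

(* The final configuration, if the machine halts within [t] steps. *)
Fixpoint run (t : nat) (c : config) : option config :=
  if step c is Some c' then
    if t is t'.+1 then run t' c' else None
  else Some c.

Definition outputs (c : config) (v : seq O) : Prop :=
  exists k, chead c :: cright c = map output_cell v ++ nseq k None.

End Machine.

Definition polytime (I O : finType) (f : seq I -> seq O) : Prop :=
  exists (M : machine I O) (p : {poly nat}), forall w,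
    exists2 c, run (p.[size w])%R (initial M w) = Some c & outputs c (f w).

(** ** Proof systems *)

Definition proof_system_for (Sigma : finType) (L : formula -> Prop)
    (P : seq Sigma -> formula) : Prop :=
  polytime (fun pi => formula_word (P pi)) /\
  (forall phi, L phi <-> exists pi, P pi = phi).

(* What comparisons and lower bounds depend on: proofs, their lengths, and the
   formulas they prove. *)
Record proof_notion : Type := ProofNotion {
  proof : Type;
  proof_length : proof -> nat;
  proves : proof -> formula -> Prop }.

Definition of_function (Sigma : finType) (P : seq Sigma -> formula) :
    proof_notion :=
  @ProofNotion (seq Sigma) size (fun pi phi => P pi = phi).

Definition of_calculus (inference : seq sequent -> sequent -> Prop) :
    proof_notion :=
  @ProofNotion (seq sequent) (fun pi => size (proof_word pi))
    (fun pi phi => derivation inference pi /\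
                   last ([::] ⇒ [::]) pi = ([::] ⇒ [:: phi])).

Definition CFLe : proof_notion := of_calculus (CFL false false).
Definition CFLei : proof_notion := of_calculus (CFL true false).
Definition CFLeo : proof_notion := of_calculus (CFL false true).
Definition CFLew : proof_notion := of_calculus (CFL true true).
Definition FLe : proof_notion := of_calculus FLe_inference.

Definition provable (P : proof_notion) (phi : formula) : Prop :=
  exists pi : proof P, proves pi phi.

Definition at_least_as_strong (Q P : proof_notion) : Prop :=
  forall phi, provable P phi -> provable Q phi.

Definition simulated_by (P Q : proof_notion) : Prop :=
  exists g : {poly nat}, forall (pi : proof P) (phi : formula),
    proves pi phi ->
    exists2 pi' : proof Q, proves pi' phi &
      proof_length pi' <= (g.[proof_length pi])%R.

Definition exponential_lower_bound (R : realType) (P : proof_notion) : Prop :=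
  exists A : nat -> formula,
    [/\ forall n, 1 <= n -> provable P (A n),
        exists p : {poly nat}, forall n, 1 <= n -> formula_size (A n) <= (p.[n])%R
      & exists2 e : R, (0 < e)%R &
          exists N, forall n, 1 <= n -> N <= n ->
            forall pi : proof P, proves pi (A n) ->
              (2 `^ (n%:R `^ e) <= (proof_length pi)%:R :> R)%R].

(* Main.v *)
Require Import Defs.
From mathcomp Require Import all_boot all_order all_algebra reals exp.
From mathcomp Require Import zify lra.

Set Implicit Arguments.
Unset Strict Implicit.
Unset Printing Implicit Defensive.

Import Order.TTheory GRing.Theory Num.Theory.

(** Hard formulas adapted to cut-free proofs make circuit lower bounds
    unnecessary.  Let [key], [p_i], [q_i] be
    variables, [B_i] the formula [(key * p_i) ∨ (key * q_i)], [K_i] the formula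
    [B_i * (key → K_(i+1))] with [K_n = p_n], and consider
    [K_0 → (p_(n-1) ∨ q_(n-1)) * (... * ((p_0 ∨ q_0) * p_n))].
    Opening [K_0] reveals one literal at a time, from index [0] up, while the
    conclusion asks for the last one first.  Classical countermodels show that
    no formula on the left can ever be dropped, that [key → K_(i+1)] cannot be
    used before [B_i] has been resolved, and that the conclusion cannot be
    split before all [n] literals are present.  So for each of the [2^n] choices
    of literals, a cut-free proof contains a sequent that lists exactly these
    literals, even if weakening is allowed. *)

(** * Classical soundness *)

Fixpoint eval (v : seq bool -> bool) (phi : formula) : bool :=
  match phi with
  | Var w => v w
  | Zero => false
  | One => true
  | And a b | Fus a b => eval v a && eval v b
  | Or a b => eval v a || eval v b
  | Imp a b => eval v a ==> eval v b
  end.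

Definition sat v (s : sequent) : bool := all (eval v) s.1 ==> has (eval v) s.2.

(** With fusion read as conjunction, each rule, weakenings included, is a Boolean tautology in the
    truth values of its contexts and active formulas. *)
Lemma CFL_sound i o v ps c : CFL i o ps c -> all (sat v) ps -> sat v c.
Proof.
case=> *; match goal with H : is_true (all _ _) |- _ => move: H end;
  rewrite /sat /= ?all_cat ?has_cat /= ?all_cat ?has_cat /=;
  repeat match goal with
  | |- context [all _ ?l] => case: (all _ l)
  | |- context [has _ ?l] => case: (has _ l)
  | |- context [eval _ ?l] => case: (eval _ l)
  end; by [].
Qed.

Lemma derivation_sound i o pi v : derivation (CFL i o) pi -> all (sat v) pi.
Proof.
elim=> [|{}pi ps c _ IH sub inf] //; rewrite all_rcons IH andbT.
by apply: (CFL_sound inf); apply/allP => p /sub; apply/allP.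
Qed.

(** * Composing derivations *)

Lemma derivation_mono (I J : seq sequent -> sequent -> Prop) pi :
  (forall ps c, I ps c -> J ps c) -> derivation I pi -> derivation J pi.
Proof.
move=> IJ; elim=> [|{}pi ps c _ IH sub inf]; first exact: derivation_nil.
exact: derivation_rcons IH sub (IJ _ _ inf).
Qed.

Lemma derivation_cat I pi1 pi2 :
  derivation I pi1 -> derivation I pi2 -> derivation I (pi1 ++ pi2).
Proof.
move=> d1; elim=> [|pi ps c _ IH sub inf]; first by rewrite cats0.
rewrite -rcons_cat; apply: derivation_rcons IH _ inf => p /sub.
by rewrite mem_cat orbC => ->.
Qed.

Definition derivable I c := exists pi, derivation I (rcons pi c).

Lemma derivable_step I ps c :
  (forall p, p \in ps -> derivable I p) -> I ps c -> derivable I c.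
Proof.
move=> prem inf.
suff [pi d sub] : exists2 pi, derivation I pi & {subset ps <= pi}.
  by exists pi; apply: derivation_rcons inf.
elim: ps prem {inf} => [|p ps IH] prem; first by exists [::]; first constructor.
have [pi1 d1] := prem p (mem_head _ _).
have [|pi2 d2 sub2] := IH; first by move=> q qps; apply: prem; rewrite inE qps orbT.
exists (rcons pi1 p ++ pi2); first exact: derivation_cat.
move=> q; rewrite inE mem_cat mem_rcons inE => /orP [->//|/sub2 ->].
by rewrite orbT.
Qed.

(** * The hard formulas and their cut-free proofs *)

Definition key : formula := Var [::].
Definition lit (b : bool) (i : nat) : formula := Var (b :: nseq i true).
Definition either (i : nat) : formula := Or (lit true i) (lit false i).
Definition branch (i : nat) : formula :=
  Or (Fus key (lit true i)) (Fus key (lit false i)).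

Fixpoint source (m i : nat) : formula :=
  if m is m'.+1 then Fus (branch i) (Imp key (source m' i.+1)) else lit true i.

Fixpoint target (n k : nat) : formula :=
  if k is k'.+1 then Fus (either k') (target n k') else lit true n.

Definition hard n := Imp (source n 0) (target n n).

(* The last bit of the word decides the literal of index 0, so that consing a
   bit adds the literal of the next index. *)
Fixpoint lits (bs : seq bool) : seq formula :=
  if bs is b :: bs' then lit b (size bs') :: lits bs' else [::].

(** A common core of [FLe] and every [CFL i o]: deriving the hard formulas here serves all these
    calculi at once. *)
Definition FLe_cutfree ps c :=
  CFL false false ps c /\ all single_conclusion (c :: ps).

Lemma derivable_step1 p c :
  derivable FLe_cutfree p -> FLe_cutfree [:: p] c -> derivable FLe_cutfree c.
Proof. by move=> dp; apply: derivable_step => q; rewrite inE => /eqP ->. Qed.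

Lemma derivable_step2 p q c :
  derivable FLe_cutfree p -> derivable FLe_cutfree q ->
  FLe_cutfree [:: p; q] c -> derivable FLe_cutfree c.
Proof.
move=> dp dq; apply: derivable_step => r.
by rewrite !inE => /orP [] /eqP ->.
Qed.

Lemma derivable_ax phi : derivable FLe_cutfree ([:: phi] ⇒ [:: phi]).
Proof. by apply: (@derivable_step _ [::]) => //; split=> //; constructor. Qed.

(** The newest literal is the first one asked for: [RFus] splits it off to prove the [either] of its
    index, and [lit true n] is carried on to the innermost factor. *)
Lemma derivable_target n bs :
  derivable FLe_cutfree (lit true n :: lits bs ⇒ [:: target n (size bs)]).
Proof.
elim: bs => [|b bs IH]; first exact: derivable_ax.
apply: (@derivable_step1 (lit b (size bs) :: lit true n :: lits bs ⇒
    [:: target n (size bs).+1])); last first.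
  by split=> //; apply: (@ExL _ _ [::]).
apply: derivable_step2 (_ : derivable _ ([:: lit b (size bs)] ⇒ [:: either (size bs)])) IH _.
  apply: (derivable_step1 (derivable_ax _)); split=> //.
  by case: b; [apply: (@ROr1 _ _ _ [::]) | apply: (@ROr2 _ _ _ [::])].
by split=> //; apply: (@RFus _ _ [:: _] _ [::]).
Qed.

(** Induction on the number [m] of unread indices, for all [bs]: [LOr] makes both choices of the
    next literal, and each branch spends its [key] on the implication. *)
Lemma derivable_source m bs :
  derivable FLe_cutfree (source m (size bs) :: lits bs ⇒
    [:: target (m + size bs) (m + size bs)]).
Proof.
elim: m bs => [|m IH] bs; first exact: derivable_target.
set D := [:: _]; set I := Imp key (source m (size bs).+1).
have br b : derivable FLe_cutfree
    (Fus key (lit b (size bs)) :: I :: lits bs ⇒ D).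
  apply: (@derivable_step1 (key :: lit b (size bs) :: I :: lits bs ⇒ D));
    last by split=> //; apply: (@LFus _ _ [::]).
  apply: (@derivable_step1 (key :: I :: lit b (size bs) :: lits bs ⇒ D));
    last by split=> //; apply: (@ExL _ _ [:: _]).
  apply: derivable_step2 (derivable_ax key) (IH (b :: bs)) _.
  rewrite /= addnS; split=> //.
  exact: (@LImp _ _ [:: key] key [::] [::] _ (lits (b :: bs)) D).
apply: (@derivable_step1 (branch (size bs) :: I :: lits bs ⇒ D));
  last by split=> //; apply: (@LFus _ _ [::]).
apply: derivable_step2 (br true) (br false) _.
by split=> //; apply: (@LOr _ _ [::]).
Qed.

Lemma hard_derivable n : derivable FLe_cutfree ([::] ⇒ [:: hard n]).
Proof.
have := derivable_source n [::]; rewrite addn0 => d.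
by apply: (derivable_step1 d); split=> //; apply: RImp.
Qed.

Lemma hard_provable (I : seq sequent -> sequent -> Prop) n :
  (forall ps c, FLe_cutfree ps c -> I ps c) -> provable (of_calculus I) (hard n).
Proof.
move=> sub; have [pi d] := hard_derivable n.
by exists (rcons pi ([::] ⇒ [:: hard n])); split;
  [exact: derivation_mono d | rewrite last_rcons].
Qed.

(** * Countermodels and lists of literals *)

Definition assign (l : bool) (t : nat -> bool) (w : seq bool) : bool :=
  if w is _ :: r then t (size r) else l.

(* The two kinds of countermodels: [without j] falsifies only the literals of
   index [j]; [keyless n] falsifies [key] and both factors of the target. *)
Definition without (j : nat) := assign true (fun k => k != j).
Definition keyless (n : nat) := assign false (fun k => k < n.-1).

Lemma eval_lit l t b i : eval (assign l t) (lit b i) = t i.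
Proof. by rewrite /= size_nseq. Qed.

Lemma eval_source (t : nat -> bool) m i :
  (forall k, i <= k -> t k) -> eval (assign true t) (source m i).
Proof.
elim: m i => [|m IH] i ti; first by rewrite eval_lit ti.
by rewrite /= size_nseq ti // IH // => k /ltnW; apply: ti.
Qed.

(** For [j = n] the innermost factor fails, otherwise the factor [either j]. *)
Lemma eval_target_without j n : j <= n -> eval (without j) (target n n) = false.
Proof.
rewrite leq_eqVlt => /orP [/eqP <-|].
  elim: {3}j => [|k /= ->]; last by rewrite andbF.
  by rewrite /= size_nseq eqxx.
elim: {-2}n => [|k IH] //=; rewrite ltnS leq_eqVlt !size_nseq.
by case/orP => [/eqP ->|/IH ->]; rewrite ?eqxx // andbF.
Qed.

Lemma eval_target_keyless n k : eval (keyless n) (target n k) = false.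
Proof. by elim: k => [|k /= ->]; rewrite ?andbF //= size_nseq; lia. Qed.

Lemma mem_lits y bs : y \in lits bs -> exists b, exists2 j, j < size bs & y = lit b j.
Proof.
elim: bs => //= b bs IH; rewrite inE => /orP [/eqP ->|/IH [c [j ltj ->]]].
  by exists b, (size bs).
by exists c, j => //; apply: ltnW.
Qed.

Lemma lit_inj b c i j : lit b i = lit c j -> b = c /\ i = j.
Proof. by case=> -> /(congr1 size); rewrite !size_nseq. Qed.

Lemma lits_sign bs b c j : lit b j \in lits bs -> lit c j \in lits bs -> b = c.
Proof.
elim: bs => //= d bs IH; rewrite !inE.
case/orP=> [/eqP /lit_inj [-> ->]|inb] /orP [/eqP /lit_inj [-> E]|inc] //; last exact: IH.
- by have [e [k ltk /lit_inj [_]]] := mem_lits inc; lia.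
- by have [e [k ltk /lit_inj [_]]] := mem_lits inb; lia.
Qed.

(** The head literal has the largest index, which occurs nowhere else, so heads match and the
    inclusion passes to the rest. *)
Lemma lits_inj a b : size a = size b -> {subset lits a <= lits b} -> a = b.
Proof.
elim: a b => [|x a IH] [|y b] //= [eqs] sub.
have := sub _ (mem_head _ _); rewrite eqs inE => /orP [/eqP /lit_inj [-> _]|].
  congr (_ :: _); apply: IH => // z za.
  have := sub z; rewrite !inE za orbT => /(_ isT) /orP [/eqP zE|//].
  have [e [k ltk zE']] := mem_lits za.
  by move: zE; rewrite zE' => /lit_inj [_]; lia.
by move=> /mem_lits [e [k ltk /lit_inj [_]]]; lia.
Qed.

Lemma uniq_lits bs : uniq (lits bs).
Proof.
elim: bs => //= b bs ->; rewrite andbT; apply/negP => /mem_lits [c [j ltj]].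
by move=> /lit_inj [_]; lia.
Qed.

(** * The path of a word through a proof *)

Definition tail (m i : nat) := Imp key (source m i).

(* The left-hand sides [X :: rest] met while the word [a] is read from its last
   bit on.  [X] is the only formula that is false in [keyless], so both premises
   of a multiplicative rule would need it. *)
Inductive stage (a : seq bool) : formula -> seq formula -> Prop :=
  | StageSource pre b bs : a = pre ++ b :: bs ->
      stage a (source (size pre).+1 (size bs)) (lits bs)
  | StageBranch pre b bs : a = pre ++ b :: bs ->
      stage a (branch (size bs)) (tail (size pre) (size bs).+1 :: lits bs)
  | StageFus pre b bs : a = pre ++ b :: bs ->
      stage a (Fus key (lit b (size bs))) (tail (size pre) (size bs).+1 :: lits bs)
  | StageKey pre b' b bs : a = rcons pre b' ++ b :: bs ->
      stage a key (tail (size pre).+1 (size bs).+1 :: lits (b :: bs)).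

(** The end of the path. For nonempty [a], [keyless] now falsifies the literal of index
    [(size a).-1] as well as [key], so the argument against splitting the conclusion stops here. *)
Definition full (a : seq bool) : seq formula :=
  key :: tail 0 (size a) :: lits a.

Lemma notin_lits phi bs :
  (if phi is Var (_ :: _) then false else true) -> phi \notin lits bs.
Proof. by move=> shape; apply/negP => /mem_lits [b [j _ E]]; rewrite E in shape. Qed.

Lemma stage_uniq a X rest : stage a X rest -> uniq (X :: rest).
Proof.
case=> pre => [b bs|b bs|b bs|b' b bs] _.
- by rewrite cons_uniq uniq_lits notin_lits.
- by rewrite cons_uniq inE negb_or cons_uniq uniq_lits !notin_lits.
- by rewrite cons_uniq inE negb_or cons_uniq uniq_lits !notin_lits.
- by rewrite cons_uniq inE negb_or cons_uniq uniq_lits !notin_lits.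
Qed.

(** Tails hold because [key] is false; the literals in [rest] hold because their indices are below
    [(size a).-1]. *)
Lemma stage_keyless a X rest y :
  stage a X rest -> y \in rest -> eval (keyless (size a)) y.
Proof.
have litsT bs : size bs < size a -> y \in lits bs -> eval (keyless (size a)) y.
  by move=> lta /mem_lits [c [j ltj ->]]; rewrite eval_lit; lia.
case=> pre => [b bs|b bs|b bs|b' b bs] aE.
- by apply: litsT; rewrite aE size_cat /=; lia.
- by rewrite inE => /predU1P [-> //|]; apply: litsT; rewrite aE size_cat /=; lia.
- by rewrite inE => /predU1P [-> //|]; apply: litsT; rewrite aE size_cat /=; lia.
- rewrite [y \in _]inE => /predU1P [-> //|]; apply: litsT.
  by rewrite aE size_cat size_rcons /=; lia.
Qed.

(** Take for [j] the index of [y] if [y] is a literal, and [i] if [y] is [tail m i]. The bound on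
    [j] makes the target false in [without j]. *)
Lemma stage_without a X rest y :
  stage a X rest -> y \in rest ->
  exists2 j, j <= size a &
    forall z, z \in X :: rest -> z != y -> eval (without j) z.
Proof.
have litT j bs z : z \in lits bs -> (forall b, z != lit b j) -> eval (without j) z.
  by move=> /mem_lits [b [k ltk ->]] /(_ b) nz; rewrite eval_lit; apply: contra nz => /eqP ->.
have big bs z : z \in lits bs -> forall b, z != lit b (size bs).
  by move=> /mem_lits [b [k ltk ->]] c; apply/eqP => /lit_inj [_]; lia.
have one j c bs z : z \in lits bs -> lit c j \in lits bs -> z != lit c j ->
    eval (without j) z.
  move=> zin cin nz; apply: (litT _ _ _ zin) => b; apply: contra nz => /eqP zE.
  by rewrite zE in zin; rewrite zE (lits_sign zin cin).
have src j m i : j < i -> eval (without j) (source m i).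
  by move=> ltj; apply: eval_source => k; lia.
have tailed W m i bs : size bs <= i -> i <= size a ->
    (forall j, (j < size bs) || (j == i) -> eval (without j) W) ->
    y \in tail m i :: lits bs ->
    exists2 j, j <= size a &
      forall z, z \in W :: tail m i :: lits bs -> z != y -> eval (without j) z.
  move=> lei lea WT; rewrite inE => /predU1P [->|yin].
    exists i => // z; rewrite !inE => /or3P [/eqP -> _|->//|zin _].
      by apply: WT; rewrite eqxx orbT.
    by have [c [j ltj ->]] := mem_lits zin; rewrite eval_lit; lia.
  have [c [j ltj yE]] := mem_lits yin; exists j; first by lia.
  move=> z; rewrite !inE => /or3P [/eqP -> _|/eqP -> _|zin].
  + by apply: WT; rewrite ltj.
  + by apply/implyP => _; apply: src; lia.
  + by move: yin; rewrite yE => yin; apply: one zin yin.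
case=> pre => [b bs|b bs|b bs|b' b bs] aE.
- move=> yin; have [c [j ltj yE]] := mem_lits yin; exists j.
    by rewrite aE size_cat /=; lia.
  move=> z; rewrite inE => /orP [/eqP -> _|zin]; first exact: src.
  by move: yin; rewrite yE => yin; apply: one zin yin.
- apply: tailed => [//||j]; first by rewrite aE size_cat /=; lia.
  by rewrite /= size_nseq; lia.
- apply: tailed => [//||j]; first by rewrite aE size_cat /=; lia.
  by rewrite /= size_nseq; lia.
- by apply: tailed => //=; rewrite aE size_cat size_rcons /=; lia.
Qed.

(** * Inferences whose conclusion is a stage *)

Lemma perm_middle (T : eqType) (G S r : seq T) x :
  perm_eq (G ++ x :: S) (x :: r) = perm_eq (G ++ S) r.
Proof. by rewrite -cat1s perm_catCA perm_cons. Qed.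

Lemma cat_cons_seq1 (T : Type) (D L : seq T) x y :
  D ++ x :: L = [:: y] -> [/\ D = [::], x = y & L = [::]].
Proof. by case: D => [|d [|e D]] //= [-> ->]. Qed.

Definition on_path a G :=
  perm_eq G (full a) \/ exists X rest, stage a X rest /\ perm_eq G (X :: rest).

Lemma on_path_perm a G H : perm_eq G H -> on_path a H -> on_path a G.
Proof.
move=> GH [HF|[X [rest [st HX]]]]; first by left; apply: perm_trans GH HF.
by right; exists X, rest; split=> //; apply: perm_trans GH HX.
Qed.

Lemma stage_on_path a X rest : stage a X rest -> on_path a (X :: rest).
Proof. by move=> st; right; exists X, rest. Qed.

(** Dropping [X] is refuted by [keyless], dropping a formula of [rest] by some [without j]. As the
    stage has no repetitions, no second copy of [phi] survives. *)
Lemma stage_weakening a X rest (G S : seq formula) phi :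
  stage a X rest -> perm_eq (G ++ phi :: S) (X :: rest) ->
  exists v, ~~ sat v (G ++ S ⇒ [:: target (size a) (size a)]).
Proof.
move=> st pe; have U := stage_uniq st.
have mem z : z \in G ++ S -> z \in X :: rest /\ z != phi.
  move: U; rewrite -(perm_uniq pe) -cat1s uniq_catCA cat1s cons_uniq => /andP [no _] zin.
  split; last by apply: contraNneq no => <-.
  by rewrite -(perm_mem pe) mem_cat inE orbCA -mem_cat zin orbT.
have : phi \in X :: rest by rewrite -(perm_mem pe) mem_cat mem_head orbT.
rewrite inE => /predU1P [E|phi_rest].
  exists (keyless (size a)); rewrite /sat /= eval_target_keyless /= implybF negbK.
  apply/allP => z /mem [zin nz]; apply: (stage_keyless st).
  by move: zin; rewrite inE -E (negPf nz).
have [j lej ev] := stage_without st phi_rest.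
exists (without j); rewrite /sat /= eval_target_without //= implybF negbK.
by apply/allP => z /mem [zin nz]; apply: ev.
Qed.

(** [keyless] falsifies both factors of the target, while [X], the only false formula on the left,
    lies in just one of [G] and [S]; the other premise fails. *)
Lemma stage_fusion a X rest G S D L phi psi :
  stage a X rest -> perm_eq (G ++ S) (X :: rest) ->
  D ++ Fus phi psi :: L = [:: target (size a) (size a)] ->
  exists v, ~~ (sat v (G ⇒ D ++ phi :: L) && sat v (S ⇒ D ++ psi :: L)).
Proof.
move=> st pe H; have [DE E LE] := cat_cons_seq1 H; rewrite DE LE {H DE LE}.
have [f1 f2] : eval (keyless (size a)) phi = false /\
    eval (keyless (size a)) psi = false.
  have a_gt0 : 0 < size a.
    by case: st => pre => [b bs|b bs|b bs|b' b bs] ->; rewrite size_cat /=; lia.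
  case: (size a) a_gt0 E => // n _ [-> ->]; rewrite eval_target_keyless.
  by rewrite /= !size_nseq /=; lia.
have U := stage_uniq st.
move: (U); rewrite -(perm_uniq pe) cat_uniq => /and3P [_ no _].
have out (H : seq formula) : X \notin H -> {subset H <= G ++ S} ->
    all (eval (keyless (size a))) H.
  move=> XH sub; apply/allP => z zH; apply: (stage_keyless st).
  have := sub z zH; rewrite (perm_mem pe) inE => /predU1P [zX|//].
  by rewrite -zX zH in XH.
exists (keyless (size a)); rewrite /sat /= f1 f2 /= !implybF -negb_or negbK.
have [XG|XG] := boolP (X \in G); last first.
  by rewrite out // => z zG; rewrite mem_cat zG.
rewrite orbC out // => [|z zS]; last by rewrite mem_cat zS orbT.
by apply: contra no => XS; apply/hasP; exists X.
Qed.

(** Excludes [W1] and the left rules for conjunction, and makes [X] the principal formula of [LOr]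
    and [LFus]. *)
Lemma stage_mem a X rest phi : stage a X rest -> phi \in X :: rest ->
  match phi with
  | Zero | One | And _ _ => False
  | Or _ _ | Fus _ _ => phi = X
  | _ => True
  end.
Proof.
have shape bs : phi \in lits bs -> if phi is Var _ then true else false.
  by move=> /mem_lits [b [j _ ->]].
by case=> pre => [b bs|b bs|b bs|b' b bs] _; rewrite !in_cons;
  repeat (case/predU1P => [->//|]); move/shape; case: phi {shape}.
Qed.

(** The premise to follow is the one whose literal agrees with the current bit of [a]. *)
Lemma stage_or a rest phi psi : stage a (Or phi psi) rest ->
  on_path a (phi :: rest) \/ on_path a (psi :: rest).
Proof.
move E: (Or _ _) => X st.
case: st E => // pre b bs aE [-> ->]; have := StageFus aE.
by case: b aE => _ st; [left | right]; apply: stage_on_path st.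
Qed.

Lemma stage_fus a rest phi psi :
  stage a (Fus phi psi) rest -> on_path a [:: phi, psi & rest].
Proof.
move E: (Fus _ _) => X st.
case: st E => // pre b bs aE [-> ->]; first exact: stage_on_path (StageBranch aE).
apply: (@on_path_perm _ _ (key :: tail (size pre) (size bs).+1 :: lits (b :: bs))).
  by apply/permP => f /=; lia.
(* With no bit left to read, the path has arrived at [full a]. *)
case: (lastP pre) aE => [->|pre' b' aE]; first by left.
by rewrite size_rcons; apply: stage_on_path (StageKey aE).
Qed.

(** The left premise, tested in [keyless], forces [X] into [G]. If [X] still hides a literal, the
    right premise fails; if [X] is [key], all literals must go to the right premise, which is then
    the next stage. *)
Lemma stage_imp a X rest (P G S : seq formula) phi psi :
  stage a X rest -> perm_eq (P ++ G ++ Imp phi psi :: S) (X :: rest) ->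
  (forall v, sat v (G ⇒ [:: phi])) ->
  (forall v, sat v (P ++ psi :: S ⇒ [:: target (size a) (size a)])) ->
  on_path a (P ++ psi :: S).
Proof.
move=> st pe vG vS; have U := stage_uniq st.
have split z : z \in X :: rest =
    [|| z \in G, z == Imp phi psi | z \in P ++ S].
  by rewrite -(perm_mem pe) !mem_cat inE; do !case: (_ \in _); do ?case: (_ == _).
have Iin : Imp phi psi \in X :: rest by rewrite split eqxx orbT.
have {}pe : perm_eq (Imp phi psi :: G ++ (P ++ S)) (X :: rest).
  apply: perm_trans pe; apply/permP => f; rewrite /= !count_cat /=; lia.
move: (U); rewrite -(perm_uniq pe) cons_uniq mem_cat negb_or cat_uniq.
case/and4P => /andP [IG IPS] _ /hasPn GPS uPS.
have XG : phi = key -> X \in G.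
  move=> E; have := vG (keyless (size a)); rewrite /sat E /= implybF.
  apply: contraR => XG; apply/allP => z zG; apply: (stage_keyless st).
  have := split z; rewrite zG inE => /predU1P [zX|//].
  by rewrite -zX zG in XG.
have PSrest z : phi = key -> z \in P ++ S -> z \in rest /\ z != Imp phi psi.
  move=> E zin; have := split z; rewrite zin !orbT inE => /predU1P [zX|->].
    by move/GPS: zin; rewrite zX /= XG.
  by split=> //; apply: contraNneq IPS => <-.
(* Since [X] went left with its literal unreleased, the antecedent of the right premise does not
   depend on index [size bs] and holds in [without (size bs)]. *)
have blocked m bs : rest = tail m (size bs).+1 :: lits bs ->
    Imp phi psi = tail m (size bs).+1 -> size bs < size a -> on_path a (P ++ psi :: S).
  move=> restE [phiE psiE] lta; suff : false by [].
  have := vS (without (size bs)); rewrite /sat /= eval_target_without ?(ltnW lta) //= implybF.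
  apply: contraR => _; apply/allP => z.
  have good y : y \in P ++ S -> eval (without (size bs)) y.
    move=> /(PSrest _ phiE) []; rewrite restE inE /tail -phiE -psiE.
    case/predU1P => [->|]; first by rewrite eqxx.
    by move=> /mem_lits [c [j ltj ->]] _; rewrite eval_lit; lia.
  rewrite mem_cat inE => /or3P [zP|/eqP ->|zS].
  - by apply: good; rewrite mem_cat zP.
  - by rewrite psiE; apply: eval_source => k; lia.
  - by apply: good; rewrite mem_cat zS orbT.
move: Iin blocked XG PSrest.
case: st U vS vG split pe => pre => [b bs|b bs|b bs|b' b bs];
  move=> aE U vS vG split pe Iin blocked XG PSrest.
- by move: Iin; rewrite inE => /predU1P [//|/mem_lits [? [? _]]].
- move: Iin; rewrite !inE => /predU1P [//|/predU1P [E|/mem_lits [? [? _]]//]].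
  by apply: blocked E _ => //; rewrite aE size_cat /=; lia.
- move: Iin; rewrite !inE => /predU1P [//|/predU1P [E|/mem_lits [? [? _]]//]].
  by apply: blocked E _ => //; rewrite aE size_cat /=; lia.
have E : Imp phi psi = tail (size pre).+1 (size bs).+1.
  by move: Iin; rewrite 2!in_cons => /predU1P [//|/predU1P [//|/mem_lits [? [? _]]//]].
have phiE : phi = key by case: E.
have psiE : psi = source (size pre).+1 (size (b :: bs)) by case: E.
suff sub : {subset lits (b :: bs) <= P ++ S}.
  have aE' : a = pre ++ b' :: b :: bs by rewrite aE cat_rcons.
  apply: on_path_perm (stage_on_path (StageSource aE')).
  rewrite -psiE perm_middle; apply: uniq_perm; rewrite ?uniq_lits // => z.
  apply/idP/idP => [/(PSrest _ phiE) []|/sub //].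
  by rewrite in_cons -E => /predU1P [->|//]; rewrite eqxx.
(* If the literal of index [j] went to the left premise, [without j] would refute the right one. *)
move=> y yin; have [c [j ltj yE]] := mem_lits yin.
have lej : j <= size a by rewrite aE size_cat size_rcons; move: ltj => /=; lia.
have := vS (without j); rewrite /sat /= eval_target_without //= implybF.
apply: contraR => yPS; apply/allP => z.
have good x : x \in P ++ S -> eval (without j) x.
  move=> xin; have [] := PSrest _ phiE xin.
  rewrite in_cons -E => /predU1P [->|xl _]; first by rewrite eqxx.
  have [d [k ltk xE]] := mem_lits xl; rewrite xE eval_lit.
  apply: contra yPS => /eqP kj; rewrite yE; rewrite yE in yin; rewrite xE kj in xl xin.
  by rewrite (lits_sign yin xl).
rewrite mem_cat inE => /or3P [zP|/eqP ->|zS].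
- by apply: good; rewrite mem_cat zP.
- by rewrite psiE; apply: eval_source => k; move: ltj => /=; lia.
- by apply: good; rewrite mem_cat zS orbT.
Qed.

(** Make every variable true. This refutes premises with empty succedent, as produced by right
    weakening, or by [LImp] when the target goes to the left premise. *)
Lemma stage_satisfiable a X rest : stage a X rest ->
  exists v, all (eval v) (X :: rest) /\
    forall phi psi, Imp phi psi \in X :: rest -> eval v psi.
Proof.
set v := assign true xpredT; move=> st; exists v.
have src m i : eval v (source m i) by apply: eval_source.
have litT bs y : y \in lits bs -> eval v y by move=> /mem_lits [b [j _ ->]].
have litI bs phi psi : Imp phi psi \in lits bs -> eval v psi by move=> /mem_lits [b [j _]].
have tailT m i bs W : eval v W -> (forall phi psi, W <> Imp phi psi) ->
    all (eval v) (W :: tail m i :: lits bs) /\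
    forall phi psi, Imp phi psi \in W :: tail m i :: lits bs -> eval v psi.
  move=> WT WI; split=> [|phi psi].
    by rewrite /= WT src; apply/allP => y; apply: litT.
  rewrite !in_cons => /predU1P [/esym /WI//|/predU1P [[_ ->]|/litI] //].
case: st => pre => [b bs|b bs|b bs|b' b bs] _; try exact: tailT.
split=> [|phi psi]; last by rewrite in_cons => /predU1P [//|/litI].
by rewrite /= -/(source _.+1 _) src; apply/allP => y; apply: litT.
Qed.

(** Left exchange, [LOr], [LFus] and [LImp] keep a premise on the path. The other rules are excluded
    by the shape of the sequent or by a countermodel to a premise. *)
Lemma stage_step a X rest ps c :
  stage a X rest -> perm_eq c.1 (X :: rest) ->
  c.2 = [:: target (size a) (size a)] ->
  CFL true true ps c -> (forall v, all (sat v) ps) ->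
  exists2 p, p \in ps & on_path a p.1 /\ p.2 = [:: target (size a) (size a)].
Proof.
move=> st + + inf; set t := target _ _.
have [k [t2 tE]] : exists k t2, t = Fus (either k) t2.
  rewrite /t; case E: (size a) => [|n]; last by do 2!eexists.
  by move: E; case: st => pre => [b bs|b bs|b bs|b' b bs] ->; rewrite size_cat addnS.
have mem (G S : seq formula) phi : perm_eq (G ++ phi :: S) (X :: rest) -> phi \in X :: rest.
  by move=> pe; rewrite -(perm_mem pe) mem_cat mem_head orbT.
have dec (G S r : seq formula) : on_path a (r ++ rest) ->
    perm_eq (G ++ X :: S) (X :: rest) -> on_path a (G ++ r ++ S).
  move=> on; rewrite perm_middle => pe; apply: on_path_perm on.
  by rewrite perm_catCA perm_cat2l.
have nonempty G : perm_eq G (X :: rest) -> exists v, ~~ sat v (G ⇒ [::]).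
  have [v [vT _]] := stage_satisfiable st; move=> pe; exists v.
  by rewrite /sat /= implybF negbK (perm_all _ pe).
case: inf => /= [phi|||G phi psi S D|G D phi psi L|G S D|G D L|G phi psi S D
    |G phi psi S D|G D phi psi L|G phi psi S D|G D phi psi L|G D phi psi L
    |G phi psi S D|G S D phi psi L|G phi L P psi S D|phi G psi D
    |G phi S D _|G D phi L _] pe.
(* An axiom would put the target on the left, where a fusion can only be [X], whose first factor is
   a [branch] or [key], never an [either]. *)
- move=> [E] _; have := mem [::] [::] phi pe; rewrite E tE => tin.
  by move: (stage_mem st tin) => /= XE; case: st XE.
- by have := perm_size pe.
- by [].
- move=> -> _; exists (G ++ phi :: psi :: S ⇒ [:: t]); rewrite ?mem_head //; split=> //=.
  apply: on_path_perm (stage_on_path st); apply: perm_trans pe.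
  by apply/permP => f; rewrite !count_cat /= (addnCA (f phi)).
- by case: D => [|? [|? ?]].
- by have := stage_mem st (mem _ _ _ pe).
- by move=> H; have [_] := cat_cons_seq1 H; rewrite tE.
- by have := stage_mem st (mem _ _ _ pe).
- by have := stage_mem st (mem _ _ _ pe).
- by move=> H; have [_] := cat_cons_seq1 H; rewrite tE.
- move=> -> _; have /= XE := stage_mem st (mem _ _ _ pe).
  move: (st); rewrite -XE => /stage_or [] on.
  + exists (G ++ phi :: S ⇒ [:: t]); rewrite ?inE ?eqxx //; split=> //=.
    by apply: (dec _ _ [:: phi]) => //; rewrite -{1}XE.
  + exists (G ++ psi :: S ⇒ [:: t]); rewrite ?inE ?eqxx ?orbT //; split=> //=.
    by apply: (dec _ _ [:: psi]) => //; rewrite -{1}XE.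
- by move=> H; have [_] := cat_cons_seq1 H; rewrite tE.
- by move=> H; have [_] := cat_cons_seq1 H; rewrite tE.
- move=> -> _; have /= XE := stage_mem st (mem _ _ _ pe).
  move: (st); rewrite -XE => /stage_fus on.
  exists (G ++ phi :: psi :: S ⇒ [:: t]); rewrite ?mem_head //; split=> //=.
  by apply: (dec _ _ [:: phi; psi]) => //; rewrite -{1}XE.
- move=> E vps; have [v] := stage_fusion st pe E.
  by have /= := vps v; rewrite andbT => ->.
(* If [D] is empty, the right premise has an empty succedent. *)
- case: D => [|d [|? ?]] //= => [LE|[-> LE]] vps.
    suff [v] : exists v, ~~ sat v (P ++ psi :: S ⇒ [::]).
      by have /= := vps v; rewrite andbT => /andP [_ ->].
    have [v [vT vI]] := stage_satisfiable st; exists v.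
    rewrite /sat /= implybF negbK all_cat /=; move: vT; rewrite -(perm_all _ pe) !all_cat /=.
    rewrite (vI phi psi) => [/and4P [-> _ _ ->] //|].
    by rewrite -(perm_mem pe) !mem_cat mem_head !orbT.
  exists (P ++ psi :: S ⇒ [:: t]); rewrite ?inE ?eqxx ?orbT //; split=> //=.
  apply: stage_imp st pe _ _ => v; have /= := vps v; rewrite LE andbT => /andP [] //.
- by rewrite tE.
- move=> -> vps; have [v] := stage_weakening st pe.
  by have /= := vps v; rewrite andbT => ->.
- move=> H vps; have [DE _ LE] := cat_cons_seq1 H; subst D L; have [v] := nonempty _ pe.
  by have /= := vps v; rewrite andbT => ->.
Qed.

(** * Counting the ends of the paths *)

Lemma path_reaches_full a pi c :
  derivation (CFL true true) pi -> c \in pi -> on_path a c.1 ->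
  c.2 = [:: target (size a) (size a)] ->
  exists2 d, d \in pi & perm_eq d.1 (full a).
Proof.
(* Premises occur earlier in the list, so following them from [c] must stop, and it can stop only at
   [full a]. *)
move=> der; elim: der c => [//|{}pi ps c0 der IH sub inf] c.
rewrite mem_rcons inE => /predU1P [->|cpi].
  case=> [full_c|[X [rest [st pe]]]] cE.
    by exists c0; rewrite // mem_rcons mem_head.
  have vps v : all (sat v) ps.
    by apply/allP => p /sub; apply/allP; apply: derivation_sound der.
  have [p /sub ppi [onp pE]] := stage_step st pe cE inf vps.
  by have [d dpi dE] := IH p ppi onp pE; exists d; rewrite // mem_rcons inE dpi orbT.
move=> onc cE; have [d dpi dE] := IH c cpi onc cE.
by exists d; rewrite // mem_rcons inE dpi orbT.
Qed.

Lemma hard_visits n (a : n.-tuple bool) pi :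
  0 < n -> derivation (CFL true true) pi ->
  last ([::] ⇒ [::]) pi = ([::] ⇒ [:: hard n]) ->
  exists2 d, d \in pi & perm_eq d.1 (full a).
Proof.
move=> n_gt0 der; case: der => [//|{}pi ps c der sub inf].
rewrite last_rcons => cE.
have vps v : all (sat v) ps.
  by apply/allP => p /sub; apply/allP; apply: derivation_sound der.
suff sps : ([:: source n 0] ⇒ [:: target n n]) \in ps.
  have [||d dpi dE] := path_reaches_full (a := a) der (sub _ sps); last 1 first.
  - by exists d; rewrite // mem_rcons inE dpi orbT.
  - have aE := size_tuple a; case: (lastP a) aE => [|pre b]; first by rewrite /= => aE; lia.
    rewrite size_rcons => <-; apply: stage_on_path.
    by apply: (@StageSource _ pre b [::]); rewrite cats1.
  - by rewrite size_tuple.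
(* Besides [RImp] only right weakening fits the endsequent, and its premise would be the invalid
   empty sequent. *)
case: inf cE vps {sub der} => /= [phi|||G phi psi S D|G D phi psi L|G S D|G D L|G phi psi S D
    |G phi psi S D|G D phi psi L|G phi psi S D|G D phi psi L|G D phi psi L
    |G phi psi S D|G S D phi psi L|G phi L P psi S D|phi G psi D
    |G phi S D _|G D phi L _] [] //; try by case: G.
- by move=> _; case: D => [|? [|? ?]].
- by move=> _ H; have [_] := cat_cons_seq1 H.
- by move=> _ H; have [_] := cat_cons_seq1 H.
- by move=> _ H; have [_] := cat_cons_seq1 H.
- by move=> _ H; have [_] := cat_cons_seq1 H.
- by move=> _ H; have [_] := cat_cons_seq1 H.
- by case: P => //; case: G.
- by move=> -> -> -> -> _; rewrite mem_head.
- move=> -> H /(_ xpredT); have [DE _ LE] := cat_cons_seq1 H; subst D L.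
  by [].
Qed.

Lemma full_inj a b G :
  size a = size b -> perm_eq G (full a) -> perm_eq G (full b) -> a = b.
Proof.
move=> sab pa pb; apply: (lits_inj sab) => z za.
have : z \in full b.
  by rewrite -(perm_mem pb) (perm_mem pa) !inE za !orbT.
by have [c [j _ ->]] := mem_lits za; rewrite !in_cons.
Qed.

(** Sending a word [a] to the first position whose antecedent permutes [full a] is injective.
    Positions in the list are counted, so reusing a sequent as a premise saves nothing. *)
Lemma hard_size n pi :
  0 < n -> derivation (CFL true true) pi ->
  last ([::] ⇒ [::]) pi = ([::] ⇒ [:: hard n]) -> 2 ^ n <= size pi.
Proof.
move=> n_gt0 der lastE.
pose at_ (a : n.-tuple bool) (d : sequent) := perm_eq d.1 (full a).
have visit a : has (at_ a) pi.
  by have [d dpi dE] := hard_visits a n_gt0 der lastE; apply/hasP; exists d.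
have lt_find a : find (at_ a) pi < size pi by rewrite -has_find.
pose f a := Ordinal (lt_find a).
have f_inj : injective f.
  move=> a b [] fE; apply/val_inj.
  apply: (@full_inj _ _ (nth ([::] ⇒ [::]) pi (find (at_ a) pi)).1).
  - by rewrite !size_tuple.
  - exact: (nth_find ([::] ⇒ [::]) (visit a)).
  - by rewrite fE; apply: (nth_find ([::] ⇒ [::]) (visit b)).
by have := leq_card f f_inj; rewrite card_tuple card_bool card_ord.
Qed.

Lemma size_proof_word pi : size pi <= size (proof_word pi).
Proof.
elim: pi => //= s pi IH; rewrite /proof_word /= size_cat size_rcons.
by apply: (@leq_add 1).
Qed.

Lemma hard_length n (pi : proof CFLew) :
  0 < n -> proves pi (hard n) -> 2 ^ n <= proof_length pi.
Proof.
move=> n_gt0 [der lastE]; exact: leq_trans (hard_size n_gt0 der lastE) (size_proof_word _).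
Qed.

(** * Size of the hard formulas *)

Lemma formula_size_lit b i : formula_size (lit b i) = i.+2.
Proof. by rewrite /formula_size /= size_map size_nseq. Qed.

Lemma formula_size_bin a b :
  [/\ formula_size (Or a b) = (formula_size a + formula_size b).+3,
      formula_size (Fus a b) = (formula_size a + formula_size b).+3
    & formula_size (Imp a b) = (formula_size a + formula_size b).+3].
Proof. by split; rewrite /formula_size /= size_cat /= size_rcons !addnS. Qed.

(** A level adds [2 * i + 22] symbols, and [i + m] is constant along the recursion, so one generous
    summand bounds every level. *)
Lemma formula_size_source m i :
  formula_size (source m i) <= m.+1 * (2 * (i + m) + 30).
Proof.
elim: m i => [|m IH] i; first by rewrite formula_size_lit; lia.
have key1 : formula_size key = 1 by [].
have [_ -> _] := formula_size_bin (branch i) (Imp key (source m i.+1)).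
have [_ _ ->] := formula_size_bin key (source m i.+1).
have [-> _ _] := formula_size_bin (Fus key (lit true i)) (Fus key (lit false i)).
have [_ -> _] := formula_size_bin key (lit true i).
have [_ -> _] := formula_size_bin key (lit false i).
rewrite !formula_size_lit key1; have := IH i.+1; nia.
Qed.

Lemma formula_size_target n k :
  k <= n -> formula_size (target n k) <= k.+1 * (2 * n + 30).
Proof.
elim: k => [|k IH] lekn; first by rewrite formula_size_lit; lia.
have [_ -> _] := formula_size_bin (either k) (target n k).
have [-> _ _] := formula_size_bin (lit true k) (lit false k).
rewrite !formula_size_lit; have := IH (ltnW lekn); nia.
Qed.

Lemma formula_size_hard n : formula_size (hard n) <= 100 * n.+1 ^ 2.
Proof.
have [_ _ ->] := formula_size_bin (source n 0) (target n n).
have := formula_size_source n 0; have := formula_size_target (leqnn n); nia.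
Qed.

(** * From polynomial simulation to the exponential bound *)

Lemma horner_nat_bound (g : {poly nat}) :
  exists C d, forall m, (g.[m])%R <= C * m.+1 ^ d.
Proof.
(* The base [m.+1] is positive even for [m = 0], so its powers grow with the exponent. *)
exists (\sum_(i < size g) (g`_i)%R), (size g) => m.
rewrite horner_coef -[X in X <= _]/(\sum_(i < size g) _)%R big_distrl /=.
have pw k : (GRing.exp m k) = m ^ k by elim: k => // k IH; rewrite exprS IH expnS.
apply: leq_sum => i _; rewrite pw leq_mul2l; apply/orP; right.
apply: leq_trans (_ : m.+1 ^ i <= _); first by case: (nat_of_ord i) => // k; rewrite leq_exp2r.
by rewrite leq_pexp2l // ltnW.
Qed.

(** Let [r] be the square root of [n]. If [m < 2^r], then [m + 1 <= 2^(r+1)], and [C <= 2^C]; taking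
    logarithms, [r^2 <= C + (r+1) * d], against [r >= C + d + 1]. *)
Lemma two_powR_sqrt_le (R : realType) (C d n m : nat) :
  (C + d).+1 ^ 2 <= n -> 2 ^ n <= C * m.+1 ^ d ->
  (2 `^ (n%:R `^ 2^-1) <= m%:R :> R)%R.
Proof.
move=> len le2; rewrite leNgt; apply/negP => ltm.
rewrite powR12_sqrt ?ler0n // in ltm; set r := Num.sqrt _ in ltm.
have rr : (r * r = n%:R)%R by rewrite -expr2 sqr_sqrtr ?ler0n.
have r_ge : ((C + d).+1%:R <= r)%R.
  rewrite -(@ler_pXn2r _ 2) ?nnegrE ?ler0n ?sqrtr_ge0 //.
  by rewrite expr2 [(r ^+ 2)%R]expr2 rr -natrM ler_nat.
have m1 : (m.+1%:R <= 2 `^ (r + 1) :> R)%R.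
  rewrite powRD ?pnatr_eq0 ?implybT // powRr1 ?ler0n // -natr1.
  have : (1 <= 2 `^ r :> R)%R.
    by rewrite -[X in (X <= _)%R](powRr0 2) ler_powR ?ler1n ?sqrtr_ge0.
  lra.
have : ((2 ^ n)%:R <= (C * m.+1 ^ d)%:R :> R)%R by rewrite ler_nat.
rewrite natrM !natrX -powR_mulrn ?ler0n // => le2R.
have CC : (C%:R <= 2 `^ C%:R :> R)%R.
  by rewrite powR_mulrn ?ler0n // -natrX ler_nat ltnW // ltn_expl.
have md : (m.+1%:R ^+ d <= 2 `^ ((r + 1) * d%:R) :> R)%R.
  by rewrite powRrM powR_mulrn ?powR_ge0 // lerXn2r ?nnegrE ?ler0n ?powR_ge0.
have := le_trans le2R (ler_pM (ler0n _ _) (exprn_ge0 _ (ler0n _ _)) CC md).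
rewrite -powRD ?pnatr_eq0 ?implybT // -rr.
rewrite -ler_ln ?posrE ?powR_gt0 ?ltr0n // !ln_powR ler_pM2r ?ln_gt0 ?ltr1n // => H.
move: r_ge; rewrite -natr1 natrD => r_ge.
have C0 : (0 <= C%:R :> R)%R by []. have d0 : (0 <= d%:R :> R)%R by [].
nra.
Qed.

Lemma simulated_lower_bound (R : realType) (P : proof_notion) :
  (forall n, provable P (hard n)) -> simulated_by P CFLew ->
  exponential_lower_bound R P.
Proof.
move=> prov [g sim]; exists hard; split=> //.
  exists (100%N *: ('X + 1) ^+ 2)%R => n _; apply: leq_trans (formula_size_hard n) _.
  by rewrite !hornerE -[(n + 1)%R]/(n + 1)%N addn1 leqnn.
have [C [d gb]] := horner_nat_bound g.
(* Passing from [n] to its square root absorbs the polynomial [g] for large [n]. *)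
exists (2^-1)%R; first by rewrite invr_gt0 ltr0n.
exists ((C + d).+1 ^ 2) => n n_gt0 len pi pin.
have [pi' pi'n le_g] := sim pi _ pin.
apply: two_powR_sqrt_le len _.
exact: leq_trans (hard_length n_gt0 pi'n) (leq_trans le_g (gb _)).
Qed.

Lemma CFL_mono (i o : bool) ps c : CFL i o ps c -> CFL true true ps c.
Proof. by case=> *; constructor. Qed.

Lemma CFL_lower_bound (R : realType) i o :
  exponential_lower_bound R (of_calculus (CFL i o)).
Proof.
apply: simulated_lower_bound => [n|].
  apply: hard_provable => ps c [inf _].
  by case: inf => *; constructor.
(* The identity on proofs is a simulation. *)
exists 'X%R => pi phi [der lastE]; exists pi; last by rewrite hornerX.
by split=> //; apply: derivation_mono der => ps c; apply: CFL_mono.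
Qed.

Theorem corollary6p8 (R : realType) :
  (forall (Sigma : finType) (L : formula -> Prop) (P : seq Sigma -> formula),
     proof_system_for L P ->
     at_least_as_strong (of_function P) FLe ->
     simulated_by (of_function P) CFLew ->
     exponential_lower_bound R (of_function P))
  /\ exponential_lower_bound R CFLe
  /\ exponential_lower_bound R CFLei
  /\ exponential_lower_bound R CFLeo.
Proof.
split; last by split; [|split]; apply: CFL_lower_bound.
move=> Sigma L P _ strong; apply: simulated_lower_bound => n; apply: strong.
by apply: hard_provable => ps c []; apply: FLe_base.
Qed.
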